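(* Let $((\mathfrak g,[\cdot,\cdot]_{\mathfrak g}),\rho,T)$ be a relative Rota-Baxter Lie algebra over $\mathbf K$. Then there is a one-to-one correspondence between equivalence classes of infinitesimal deformations of $((\mathfrak g,[\cdot,\cdot]_{\mathfrak g}),\rho,T)$ and the second cohomology group $\mathcal H^2(\mathfrak g,\rho,T)$.
   Context: $\mathbf K$ is a field of characteristic $0$; $\mathbb S_{(i,j)}$ denotes $(i,j)$-shuffles. Relative Rota-Baxter Lie algebra: a triple $((\mathfrak g,[\cdot,\cdot]_{\mathfrak g}),\rho,T)$ with $(\mathfrak g,[\cdot,\cdot]_{\mathfrak g})$ a Lie algebra, $\rho:\mathfrak g\to\mathfrak{gl}(V)$ a representation, and $T:V\to\mathfrak g$ linear with $[Tu,Tv]_{\mathfrak g}=T(\rho(Tu)(v)-\rho(Tv)(u))$ for all $u,v\in V$. A homomorphism from $((\mathfrak g',\{\cdot,\cdot\}_{\mathfrak g'}),\rho',T')$ to $((\mathfrak g,[\cdot,\cdot]_{\mathfrak g}),\rho,T)$ is a pair of a Lie algebra homomorphism $\phi:\mathfrak g'\to\mathfrak g$ and a linear map $\varphi:V'\to V$ with $T\circ\varphi=\phi\circ T'$ and $\varphi(\rho'(x)(u))=\rho(\phi(x))(\varphi(u))$; it is an isomorphism if $\phi,\varphi$ are invertible. For a commutative ring $\mathsf R$, $\mathsf R$-relative Rota-Baxter Lie algebras and their homomorphisms are defined in the same way with $\mathsf R$-modules and $\mathsf R$-linear maps. Deformations: let $\mathsf R=\mathbf K[t]/(t^2)$ with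 augmentation $\epsilon:\mathsf R\to\mathbf K$, and view $((\mathfrak g,[\cdot,\cdot]_{\mathfrak g}),\rho,T)$ as an $\mathsf R$-relative Rota-Baxter Lie algebra via $\epsilon$. An infinitesimal deformation consists of an $\mathsf R$-Lie algebra structure $[\cdot,\cdot]_{\mathsf R}$ on $\mathsf R\otimes_{\mathbf K}\mathfrak g$, an $\mathsf R$-Lie algebra homomorphism $\rho_{\mathsf R}:\mathsf R\otimes_{\mathbf K}\mathfrak g\to\mathfrak{gl}_{\mathsf R}(\mathsf R\otimes_{\mathbf K}V)$, and an $\mathsf R$-linear relative Rota-Baxter operator $T_{\mathsf R}:\mathsf R\otimes_{\mathbf K}V\to\mathsf R\otimes_{\mathbf K}\mathfrak g$, such that $(\epsilon\otimes\mathrm{Id}_{\mathfrak g},\epsilon\otimes\mathrm{Id}_V)$ is an $\mathsf R$-relative Rota-Baxter Lie algebra homomorphism from $((\mathsf R\otimes\mathfrak g,[\cdot,\cdot]_{\mathsf R}),\rho_{\mathsf R},T_{\mathsf R})$ to $((\mathfrak g,[\cdot,\cdot]_{\mathfrak g}),\rho,T)$. Two infinitesimal deformations $((\mathsf R\otimes\mathfrak g,[\cdot,\cdot]_{\mathsf R}),\rho_{\mathsf R},T_{\mathsf R})$ and $((\mathsf R\otimes\mathfrak g,[\cdot,\cdot]'_{\mathsf R}),\rho'_{\mathsf R},T'_{\mathsf R})$ are equivalent if there is an $\mathsf R$-relative Rota-Baxter Lie algebra isomorphism $(\phi,\varphi)$ from the second to the first with $(\epsilon\otimes\mathrm{Id}_{\mathfrak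 g},\epsilon\otimes\mathrm{Id}_V)\circ(\phi,\varphi)=(\epsilon\otimes\mathrm{Id}_{\mathfrak g},\epsilon\otimes\mathrm{Id}_V)$. Cohomology: let $\mu=[\cdot,\cdot]_{\mathfrak g}$, $\pi=\mu+\rho$. On $\bigoplus_{n\ge0}\mathrm{Hom}(\wedge^{n+1}(\mathfrak g\oplus V),\mathfrak g\oplus V)$ (the $n$-th summand in degree $n$) the Nijenhuis-Richardson bracket is $[P,Q]_{NR}=P\bar\circ Q-(-1)^{pq}Q\bar\circ P$ with $(P\bar\circ Q)(x_1,\dots,x_{p+q+1})=\sum_{\sigma\in\mathbb S_{(q+1,p)}}(-1)^\sigma P(Q(x_{\sigma(1)},\dots,x_{\sigma(q+1)}),x_{\sigma(q+2)},\dots,x_{\sigma(p+q+1)})$. Multilinear maps $f:\wedge^k\mathfrak g\otimes\wedge^lV\to\mathfrak g$ (or $\to V$) are regarded as elements of degree $k+l-1$ via $\hat f((x_1,v_1),\dots,(x_{k+l},v_{k+l}))=\sum_{\tau\in\mathbb S_{(k,l)}}(-1)^\tau f(x_{\tau(1)},\dots,x_{\tau(k)},v_{\tau(k+1)},\dots,v_{\tau(k+l)})$ in the summand $\mathfrak g$ (respectively $V$). Put $\mathfrak C^0(\mathfrak g,\rho,T)=0$, $\mathfrak C^1(\mathfrak g,\rho,T)=\mathfrak{gl}(\mathfrak g)\oplus\mathfrak{gl}(V)$, $\mathfrak C^n(\mathfrak g,\rho,T)=\mathrm{Hom}(\wedge^n\mathfrak g,\mathfrak g)\oplus\mathrm{Hom}(\wedge^{n-1}\mathfrak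 g\otimes V,V)\oplus\mathrm{Hom}(\wedge^{n-1}V,\mathfrak g)$ for $n\ge2$, and $\mathcal D(f,\theta)=(-1)^{n-2}\big(-[\pi,f]_{NR},[[\pi,T]_{NR},\theta]_{NR}+\frac1{n!}\underbrace{[\cdots[[}_nf,T]_{NR},T]_{NR},\cdots,T]_{NR}\big)$ (with $\theta=0$ if $n=1$). $\mathcal H^n(\mathfrak g,\rho,T)$ is the $n$-th cohomology of this complex. *)

(* Defs.v *)
From HB Require Import structures.
From mathcomp Require Import all_boot all_order all_fingroup all_algebra.
From mathcomp Require Import sesquilinear qpoly.
From mathcomp Require Import boolp classical_sets functions.

Set Implicit Arguments.
Unset Strict Implicit.
Unset Printing Implicit Defensive.

Import GRing.Theory.
Local Open Scope ring_scope.

(* Set of classes of [E]; when [E] is an equivalence relation, this is the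
   quotient of [T] by [E]. *)
Definition eq_classes (T : Type) (E : T -> T -> Prop) : Type :=
  {C : set T | exists x, C = E x}.

(* gl_R(V) is the algebra of R-linear endomorphisms of V, so an R-linear map
   rho : g -> gl_R(V) is an R-bilinear map g -> V -> V. *)
Record relRB (R : comNzRingType) (g V : lmodType R) := RelRB {
  brk : g -> g -> g;
  act : g -> V -> V;
  rbo : V -> g;
  brk_bilinear : bilinear_for *:%R *:%R brk;
  brk_alt : forall x, brk x x = 0;
  brk_jacobi : forall x y z,
    brk x (brk y z) + brk y (brk z x) + brk z (brk x y) = 0;
  act_bilinear : bilinear_for *:%R *:%R act;
  act_brk : forall x y v, act (brk x y) v = act x (act y v) - act y (act x v);
  rbo_linear : linear rbo;
  rbo_RB : forall u v,
    brk (rbo u) (rbo v) = rbo (act (rbo u) v - act (rbo v) u)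
}.

Record relRB_hom (R : comNzRingType) (g' V' g V : lmodType R)
    (A' : relRB g' V') (A : relRB g V) (phi : g' -> g) (vphi : V' -> V) : Prop :=
  RelRBHom {
  hom_linear : linear phi;
  hom_linearV : linear vphi;
  hom_brk : forall x y, phi (brk A' x y) = brk A (phi x) (phi y);
  hom_rbo : forall u, rbo A (vphi u) = phi (rbo A' u);
  hom_act : forall x u, vphi (act A' x u) = act A (phi x) (vphi u)
}.

Record relRB_iso (R : comNzRingType) (g' V' g V : lmodType R)
    (A' : relRB g' V') (A : relRB g V) (phi : g' -> g) (vphi : V' -> V) : Prop :=
  RelRBIso {
  iso_hom : relRB_hom A' A phi vphi;
  iso_bij : bijective phi;
  iso_bijV : bijective vphi
}.

Notation dual K := {poly %/ ('X^2 : {poly K})}.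

Section Scalars.
Variable K : fieldType.
Implicit Types (r s : dual K) (U : lmodType K).

Definition aug r : K := (r : {poly K})`_0.
Definition eps_part r : K := (r : {poly K})`_1.

Let coef_modX2 (p : {poly K}) i : (i < 2)%N ->
  (Pdiv.CommonRing.rmodp p (mk_monic 'X^2))`_i = p`_i.
Proof.
move=> i2; rewrite mk_monic_Xn.
rewrite [in RHS](Pdiv.RingMonic.rdivp_eq (monicXn _ 2) p).
by rewrite coefD coefMXn i2 add0r.
Qed.

Let coef_dualM r s i : (i < 2)%N ->
  (r * s : dual K)`_i = ((r : {poly K}) * (s : {poly K}))`_i.
Proof. by move=> i2; rewrite poly_of_qpolyM coef_modX2. Qed.

Lemma augM r s : aug (r * s) = aug r * aug s.
Proof. by rewrite /aug coef_dualM // coefM big_ord1. Qed.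

Lemma eps_partM r s :
  eps_part (r * s) = aug r * eps_part s + eps_part r * aug s.
Proof.
by rewrite /eps_part coef_dualM // coefM big_ord_recr big_ord1 /= subnn.
Qed.

Lemma aug1 : aug 1 = 1. Proof. by rewrite /aug coef1. Qed.
Lemma eps_part1 : eps_part 1 = 0. Proof. by rewrite /eps_part coef1. Qed.
Lemma augD r s : aug (r + s) = aug r + aug s. Proof. exact: coefD. Qed.
Lemma eps_partD r s : eps_part (r + s) = eps_part r + eps_part s.
Proof. exact: coefD. Qed.
End Scalars.

(* A K-module seen as a K[t]/(t^2)-module through the augmentation. *)
Definition via_aug (K : fieldType) (U : lmodType K) : Type := U.

Section ViaAug.
Variables (K : fieldType) (U : lmodType K).

HB.instance Definition _ := GRing.Zmodule.copy (via_aug U) U.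

Definition via_aug_scale (r : dual K) (x : via_aug U) : via_aug U :=
  aug r *: (x : U).

Let scaleA r s x : via_aug_scale r (via_aug_scale s x) = via_aug_scale (r * s) x.
Proof. by rewrite /via_aug_scale scalerA augM. Qed.
Let scale1 : left_id 1 via_aug_scale.
Proof. by move=> x; rewrite /via_aug_scale aug1 scale1r. Qed.
Let scaleDr : right_distributive via_aug_scale +%R.
Proof. by move=> r x y; apply: scalerDr. Qed.
Let scaleDl x : {morph via_aug_scale^~ x : r s / r + s}.
Proof. by move=> r s; rewrite /via_aug_scale augD scalerDl. Qed.

HB.instance Definition _ := GRing.Zmodule_isLmodule.Build (dual K) (via_aug U)
  scaleA scale1 scaleDr scaleDl.
End ViaAug.

(* The tensor product K[t]/(t^2) (x)_K U. As K[t]/(t^2) is free over K on 1, t,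
   it is modelled by pairs, (x, y) standing for 1 (x) x + t (x) y; see
   [tens_universal], [scale_tens] and [aug_id_tens]. *)
Definition dtens (K : fieldType) (U : lmodType K) : Type := (U * U)%type.

Section DTens.
Variables (K : fieldType) (U : lmodType K).

HB.instance Definition _ := GRing.Zmodule.copy (dtens U) (U * U)%type.

Let pairP (z w : U * U) : z.1 = w.1 -> z.2 = w.2 -> z = w.
Proof. by case: z w => [? ?] [? ?] /= -> ->. Qed.

Definition dtens_scale (r : dual K) (z : dtens U) : dtens U :=
  (aug r *: z.1, aug r *: z.2 + eps_part r *: z.1).

Let scaleA r s x : dtens_scale r (dtens_scale s x) = dtens_scale (r * s) x.
Proof.
rewrite /dtens_scale /= augM eps_partM scalerDr !scalerA scalerDl addrA.
by rewrite -augM.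
Qed.
Let scale1 : left_id 1 dtens_scale.
Proof.
by case=> x y; rewrite /dtens_scale aug1 eps_part1 !scale1r scale0r addr0.
Qed.
Let scaleDr : right_distributive dtens_scale +%R.
Proof.
by move=> r x y; apply: pairP; rewrite /= !scalerDr // addrACA.
Qed.
Let scaleDl x : {morph dtens_scale^~ x : r s / r + s}.
Proof.
move=> r s; apply: pairP; rewrite /= ?augD ?eps_partD !scalerDl //.
by rewrite addrACA.
Qed.

HB.instance Definition _ := GRing.Zmodule_isLmodule.Build (dual K) (dtens U)
  scaleA scale1 scaleDr scaleDl.

Definition tens (r : dual K) (x : U) : dtens U := (aug r *: x, eps_part r *: x).

(* epsilon (x) Id *)
Definition aug_id (z : dtens U) : via_aug U := z.1.

Lemma scale_tens (r s : dual K) x : r *: tens s x = tens (r * s) x.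
Proof.
by rewrite /tens augM eps_partM scalerDl -!scalerA.
Qed.

Lemma aug_id_tens (r : dual K) x : aug_id (tens r x) = aug r *: x.
Proof. by []. Qed.

Lemma tens_universal (W : lmodType K) (b : dual K -> U -> W) :
    bilinear_for *:%R *:%R b ->
  exists! f : (U * U)%type -> W, linear f /\ forall r x, f (tens r x) = b r x.
Proof.
case=> bl br.
pose t : dual K := in_qpoly 'X^2 'X.
have tX : t = 'X :> {poly K} by apply: qpolyXE; rewrite ?size_polyXn ?monicXn.
have augt : aug t = 0 by rewrite /aug tX coefX.
have eps_partt : eps_part t = 1 by rewrite /eps_part tX coefX.
have r_dec (r : dual K) : r = aug r *: (1 : dual K) + eps_part r *: t.
  apply: val_inj; apply/polyP => i /=.
  rewrite (tX : Pdiv.CommonRing.rmodp _ _ = _) coefD !coefZ coefX coefC.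
  rewrite /aug /eps_part; case: i => [|[|i]] /=; rewrite ?mulr0 ?mulr1 ?add0r ?addr0 //.
  by rewrite big_coef_npoly // mk_monic_Xn size_polyXn.
have bZ r a x : b r (a *: x) = a *: b r x.
  have b0 : b r 0 = 0.
    by have := br r (-1) 0 0; rewrite /= scaler0 addr0 scaleN1r addNr.
  by rewrite -[a *: x]addr0 br /= b0 addr0.
have bZl r a x : b (a *: r) x = a *: b r x.
  have b0 : b 0 x = 0.
    by have := bl x (-1) 0 0; rewrite /= scaler0 addr0 scaleN1r addNr.
  by rewrite -[a *: r]addr0 (bl x) /= b0 addr0.
exists (fun z => b 1 z.1 + b t z.2); split=> [|f [fl fE]].
  split=> [a z w|r x] /=.
    by rewrite br [b t _]br scalerDr addrACA.
  by rewrite !bZ {3}(r_dec r) (bl x) bZl.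
apply/funext=> z.
pose u : U * U := tens 1 z.1; pose v : U * U := tens t z.2.
have -> : z = (1 : K) *: u + v.
  rewrite scale1r /u /v /tens aug1 eps_part1 augt eps_partt !scale1r !scale0r.
  by apply: pairP; rewrite /= ?addr0 ?add0r.
rewrite fl /u /v !fE scale1r /tens aug1 eps_part1 augt eps_partt /=.
by rewrite !scale1r !scale0r addr0 add0r.
Qed.
End DTens.

Arguments aug_id {K U} z.

Section Deformations.
Variables (K : fieldType) (g V : lmodType K) (A : relRB g V).

Program Definition relRB_via_aug : relRB (via_aug g) (via_aug V) :=
  @RelRB (dual K) (via_aug g) (via_aug V) (brk A) (act A) (rbo A)
    _ (brk_alt A) (brk_jacobi A) _ (act_brk A) _ (rbo_RB A).
Next Obligation.
by case: (brk_bilinear A) => bl br; split=> x r; [apply: bl | apply: br].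
Qed.
Next Obligation.
by case: (act_bilinear A) => bl br; split=> x r; [apply: bl | apply: br].
Qed.
Next Obligation. by move=> r; apply: (rbo_linear A). Qed.

Record deformation := Deformation {
  defm :> relRB (dtens g) (dtens V);
  defm_aug : relRB_hom defm relRB_via_aug aug_id aug_id
}.

Definition deformation_equiv (D D' : deformation) : Prop :=
  exists (phi : dtens g -> dtens g) (vphi : dtens V -> dtens V),
    [/\ relRB_iso D' D phi vphi,
        aug_id \o phi = aug_id & aug_id \o vphi = aug_id].
End Deformations.

Section Cohomology.
Variables (K : fieldType) (g V : lmodType K).

Definition altlin n (U W : lmodType K) (f : ('I_n -> U) -> W) : Prop :=
  (forall x i, linear (fun u => f [eta x with i |-> u])) /\
  (forall x i j, i != j -> x i = x j -> f x = 0).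

(* Hom(/\^k g (x) /\^l V, U) *)
Record altHom k l (U : lmodType K) := AltHom {
  alt_fun :> ('I_k -> g) -> ('I_l -> V) -> U;
  alt_funl : forall v, altlin (alt_fun^~ v);
  alt_funr : forall x, altlin (alt_fun x)
}.

Definition shuffle k n (s : 'S_n) : bool :=
  [forall i : 'I_n, forall j : 'I_n,
    (i < j)%N && ((j < k)%N || (k <= i)%N) ==> (s i < s j)%N].

(* Maps in [n] variables on g (+) V; those that are multilinear and alternating
   form the summand of degree [n - 1] of the Nijenhuis-Richardson algebra. *)
Definition mor n : Type := ('I_n -> g * V) -> g * V.

HB.instance Definition _ n :=
  GRing.Lmodule.copy (mor n) (('I_n -> g * V) -> g * V).

Definition castmor m n (e : m = n) (f : mor m) : mor n :=
  fun x => f (x \o cast_ord e).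

Section NR.
Variables p q : nat.

Definition circ (P : mor p.+1) (Q : mor q.+1) : mor (p + q).+1 := fun x =>
  \sum_(s : 'S_(p + q).+1 | shuffle q.+1 s) (-1) ^+ s *:
    P (fun i => if i == ord0 then Q (fun j => x (s (inord j)))
                else x (s (inord (q + i)))).
End NR.

Definition nr p q (P : mor p.+1) (Q : mor q.+1) : mor (p + q).+1 :=
  circ P Q - (-1) ^+ (p * q) *: castmor (congr1 S (addnC q p)) (circ Q P).

Definition hat k l (U : lmodType K) (f : ('I_k -> g) -> ('I_l -> V) -> U)
    (x : 'I_(k + l) -> g * V) : U :=
  \sum_(s : 'S_(k + l) | shuffle k s) (-1) ^+ s *:
    f (fun i => (x (s (lshift l i))).1) (fun j => (x (s (rshift k j))).2).

Definition hat_g k l (f : ('I_k -> g) -> ('I_l -> V) -> g) : mor (k + l) :=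
  fun x => (hat f x, 0).
Definition hat_V k l (f : ('I_k -> g) -> ('I_l -> V) -> V) : mor (k + l) :=
  fun x => (0, hat f x).

(* The space C^(m+1). *)
Record cochainS m := CochainS {
  coch_g : altHom m.+1 0 g;
  coch_V : altHom m 1 V;
  coch_T : altHom 0 m g;
  coch_T1 : m = 0 -> forall x v, coch_T x v = 0
}.

Definition cochain n : Type := if n is m.+1 then cochainS m else unit.

Definition lift_f m (c : cochainS m) : mor m.+1 :=
  castmor (addn0 m.+1) (hat_g (coch_g c)) + castmor (addn1 m) (hat_V (coch_V c)).
Definition lift_theta m (c : cochainS m) : mor m := hat_g (coch_T c).

Definition lift n : cochain n -> mor n * mor n.-1 :=
  match n with
  | 0 => fun=> 0
  | m.+1 => fun c => (lift_f c, lift_theta c)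
  end.

Variable A : relRB g V.

Definition pi_hat : mor 2 :=
  @hat_g 2 0 (fun x _ => brk A (x ord0) (x ord_max)) +
  @hat_V 1 1 (fun x v => act A (x ord0) (v ord0)).
Definition T_hat : mor 1 := @hat_g 0 1 (fun _ v => rbo A (v ord0)).

Definition nr_piT m : mor m -> mor m.+1 :=
  match m with
  | 0 => fun=> 0
  | q.+1 => fun theta => @nr 1 q (@nr 1 0 pi_hat T_hat) theta
  end.

Definition nr_T m (f : mor m.+1) : mor m.+1 :=
  castmor (congr1 S (addn0 m)) (@nr m 0 f T_hat).

(* In cochain degree n = m + 1, the sign (-1)^(n-2) is (-1)^n: a truncated
   subtraction would give the wrong sign for n = 1. *)
Definition coboundaryS m (c : cochainS m) : mor m.+2 * mor m.+1 :=
  (-1) ^+ m.+1 *: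
    (- @nr 1 m pi_hat (lift_f c),
     nr_piT (lift_theta c) +
       (((m.+1)`!)%:R)^-1 *: iter m.+1 (@nr_T m) (lift_f c)).

Definition coboundary n : cochain n -> mor n.+1 * mor n :=
  match n with
  | 0 => fun=> 0
  | m.+1 => fun c => coboundaryS c
  end.

Definition cocycle n : Type := {c : cochain n | coboundary c = 0}.

Definition is_coboundary n : mor n * mor n.-1 -> Prop :=
  match n with
  | 0 => fun F => F = 0
  | m.+1 => fun F => exists c : cochain m, F = coboundary c
  end.

Definition cohomologous n (z w : cocycle n) : Prop :=
  is_coboundary (lift (sval w) - lift (sval z)).

(* H^n, as the set of cosets z + B^n with z in Z^n. *)
Definition cohomology n : Type := eq_classes (@cohomologous n).
End Cohomology.

(* Main.v *)
From HB Require Import structures.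
Require Import Defs.
From mathcomp Require Import all_boot all_algebra.
From mathcomp Require Import fingroup perm sesquilinear boolp classical_sets functions.

Set Implicit Arguments.
Unset Strict Implicit.
Unset Printing Implicit Defensive.

Import GRing.Theory.
Local Open Scope ring_scope.

(** Over K[t]/(t^2) a map that is linear, resp. bilinear, and reduces to f0,
    resp. b0, modulo t has the form f0 + t f1, resp. b0 + t b1, with f1, resp.
    b1, an arbitrary map of the same kind over K ([linear_deform],
    [bilinear_deform2]). An infinitesimal deformation is therefore the same
    thing as a triple (w, s, th): the coefficients of t in the bracket, in the
    action and in the operator. Reading off the coefficient of t in the axioms
    turns them into the Jacobi identity, the representation identity and the
    Rota-Baxter identity linearised at the given structure
    ([deformation_eqns], [deformation_exists]).

    A 2-cochain is also such a triple, and its coboundary vanishes exactly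
    under the same three equations ([cocycleP]): in degree 2 all shuffle sums
    have at most three terms, the bracket with pi gives the first two equations,
    as the components of pi and of f have the shape of a semidirect product
    ([nr_pi_lift_f]), and the remaining component gives the third
    ([coboundary_snd]). In the last one the double bracket with T contributes
    twice the expected expression, which is the place where the characteristic
    must differ from 2.

    Likewise an equivalence of deformations is Id + t N on g and Id + t S on V,
    and it carries one triple to the other exactly when they differ by the
    expression [gauge_shift] in (N, S) ([deformation_equivP]), which is the
    coboundary of the 1-cochain (N, S) ([coboundary1P]). Deformations and
    cocycles are thus both parametrised by the same triples modulo the same
    relation [gauge_equiv], and their sets of classes are in bijection
    ([eq_classes_bijection]). *)

(** * Identities in abelian groups by reflection *)

(** Formal additive expressions in the entries of a list; two of them with equal
    integer coefficients have equal values in every abelian group, which is how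
    the tactic zmod below decides equations. Its atoms are compared up to
    conversion, because the same module element is reached through different
    presentations of g x g. *)
Inductive zexpr := ZVar of nat | ZZero | ZAdd of zexpr & zexpr | ZOpp of zexpr.

Fixpoint zeval (M : zmodType) (env : seq M) (e : zexpr) : M :=
  match e with
  | ZVar i => env`_i
  | ZZero => 0
  | ZAdd e1 e2 => zeval env e1 + zeval env e2
  | ZOpp e1 => - zeval env e1
  end.

Fixpoint zcoef (e : zexpr) (i : nat) : int :=
  match e with
  | ZVar j => (i == j)%:R
  | ZZero => 0
  | ZAdd e1 e2 => zcoef e1 i + zcoef e2 i
  | ZOpp e1 => - zcoef e1 i
  end.

Lemma zeval_coef (M : zmodType) (env : seq M) e :
  zeval env e = \sum_(i < size env) env`_i *~ zcoef e i.
Proof.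
elim: e => [j||e1 IH1 e2 IH2|e1 IH1] /=.
- have [lt_j|ge_j] := ltnP j (size env).
    rewrite (bigD1 (Ordinal lt_j)) //= eqxx big1 ?addr0 // => i.
    by rewrite -val_eqE /= => /negPf->.
  rewrite nth_default // big1 // => i _.
  by rewrite (ltn_eqF (leq_trans (ltn_ord i) ge_j)).
- by rewrite big1.
- by rewrite IH1 IH2 -big_split; apply: eq_bigr => i _; rewrite mulrzDr.
- by rewrite IH1 -sumrN; apply: eq_bigr => i _; rewrite mulrNz.
Qed.

Lemma zeval_eq (M : zmodType) (env : seq M) e1 e2 :
    all (fun i => zcoef e1 i == zcoef e2 i) (iota 0 (size env)) ->
  zeval env e1 = zeval env e2.
Proof.
move=> /allP eq_coef; rewrite !zeval_coef; apply: eq_bigr => i _.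
by rewrite (eqP (eq_coef i _)) // mem_iota add0n ltn_ord.
Qed.

Ltac zmod_insert a l :=
  lazymatch l with
  | nil => constr:(a :: nil)
  | ?b :: ?t =>
    match constr:(tt) with
    | _ => let _ := match constr:(tt) with _ => unify a b end in l
    | _ => let t' := zmod_insert a t in constr:(b :: t')
    end
  end.

Ltac zmod_atoms e l :=
  lazymatch e with
  | 0 => l
  | ?a + ?b => let l' := zmod_atoms a l in zmod_atoms b l'
  | - ?a => zmod_atoms a l
  | _ => zmod_insert e l
  end.

Ltac zmod_index a l :=
  lazymatch l with
  | ?b :: ?t =>
    match constr:(tt) with
    | _ => let _ := match constr:(tt) with _ => unify a b end in constr:(0%N)
    | _ => let n := zmod_index a t in constr:(n.+1)
    end
  end.

Ltac zmod_reify e l :=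
  lazymatch e with
  | 0 => constr:(ZZero)
  | ?a + ?b =>
    let ea := zmod_reify a l in let eb := zmod_reify b l in
    constr:(ZAdd ea eb)
  | - ?a => let ea := zmod_reify a l in constr:(ZOpp ea)
  | _ => let i := zmod_index e l in constr:(ZVar i)
  end.

Ltac zmod :=
  lazymatch goal with
  | |- @eq ?M ?a ?b =>
    let l := zmod_atoms a (@nil M) in
    let l := zmod_atoms b l in
    let ea := zmod_reify a l in
    let eb := zmod_reify b l in
    change (zeval l ea = zeval l eb);
    apply: zeval_eq; vm_compute; reflexivity
  end.

(** Peels off a known equation from a goal; used repeatedly it reduces an
    equation that is an integral combination of hypotheses to one for zmod. *)
Lemma eq_from_sub (M : zmodType) (a b x y : M) :
  a = b -> x - a = y - b -> x = y.
Proof. by move=> -> /addIr. Qed.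

(** * Shuffles with at most one element in one of the two blocks *)

(** An increasing permutation moves no element down; neither does its inverse,
    which is increasing too. *)
Lemma shuffle_all n (s : 'S_n) : shuffle n s = (s == 1%g).
Proof.
apply/idP/eqP=> [/forallP/= shs|->]; last first.
  by apply/forallP=> i; apply/forallP=> j; rewrite !perm1; apply/implyP=> /andP[].
have smono (i j : 'I_n) : (i < j)%N -> (s i < s j)%N.
  move=> ij; have/forallP/(_ j)/implyP := shs i; apply.
  by rewrite ij ltn_ord.
have mono_ge (t : 'S_n) : (forall i j : 'I_n, (i < j)%N -> (t i < t j)%N) ->
    forall m (i : 'I_n), i = m :> nat -> (m <= t i)%N.
  move=> tmono; elim=> // m IH i im.
  have lt_m : (m < n)%N by rewrite ltnW // -im ltn_ord.
  by apply: leq_ltn_trans (IH (Ordinal lt_m) erefl) _; apply: tmono; rewrite im.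
have sVmono (i j : 'I_n) : (i < j)%N -> (s^-1%g i < s^-1%g j)%N.
  rewrite !ltnNge; apply: contra; rewrite leq_eqVlt => /orP[/eqP/val_inj/perm_inj->//|].
  by move/smono; rewrite !permKV => /ltnW.
apply/permP=> i; rewrite perm1; apply/val_inj/eqP; rewrite eqn_leq /=.
rewrite (mono_ge _ smono _ i erefl) andbT.
by have := mono_ge _ sVmono _ (s i) erefl; rewrite permK.
Qed.

Lemma sum_shuffle_all (M : nmodType) n (F : 'S_n -> M) :
  \sum_(s | shuffle n s) F s = F 1%g.
Proof. by rewrite (eq_bigl (pred1 1%g)) ?big_pred1_eq // => s; rewrite shuffle_all. Qed.

Lemma shuffle_none n (s : 'S_n) : shuffle 0 s = (s == 1%g).
Proof.
rewrite -shuffle_all; apply/eq_forallb=> i; apply/eq_forallb=> j.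
by rewrite ltn_ord ltn0 /=.
Qed.

Lemma sum_shuffle_none (M : nmodType) n (F : 'S_n -> M) :
  \sum_(s | shuffle 0 s) F s = F 1%g.
Proof. by rewrite (eq_bigl (pred1 1%g)) ?big_pred1_eq // => s; rewrite shuffle_none. Qed.

(** Deleting one point and its image from a permutation leaves a permutation of
    the remaining points. *)
Lemma lift_perm_surj n (i : 'I_n.+1) (s : 'S_n.+1) :
  exists t, s = lift_perm i (s i) t.
Proof.
have neq k : s i != s (lift i k) by rewrite (inj_eq perm_inj) neq_lift.
pose f k := odflt k (unlift (s i) (s (lift i k))).
have fE k : lift (s i) (f k) = s (lift i k).
  by rewrite /f; case: (unlift_some (neq k)) => j -> ->.
have f_inj : injective f.
  by move=> k l /(congr1 (lift (s i))); rewrite !fE => /perm_inj/lift_inj.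
exists (perm f_inj); apply/permP=> k; case: (unliftP i k) => [j ->|->].
  by rewrite lift_perm_lift permE fE.
by rewrite lift_perm_id.
Qed.

Lemma lift_ltn n (i : 'I_n.+1) (j k : 'I_n) :
  (lift i j < lift i k)%N = (j < k)%N.
Proof. by rewrite !ltnNge /= leq_bump2. Qed.

(** A shuffle whose second block is a single point is determined by the image i
    of that point: off the point it is an increasing permutation, so it is the
    lift of the identity. *)
Lemma sum_shuffle_rcons (M : nmodType) n (F : 'S_n.+1 -> M) :
  \sum_(s | shuffle n s) F s = \sum_(i < n.+1) F (lift_perm ord_max i 1%g).
Proof.
rewrite (reindex_onto (fun i => lift_perm ord_max i 1%g) (fun s => s ord_max)) /=.
  apply: eq_bigl => i; rewrite lift_perm_id eqxx andbT; apply/forallP=> j.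
  apply/forallP=> k; apply/implyP.
  case: (unliftP ord_max j) => [j' ->|->]; case: (unliftP ord_max k) => [k' ->|->];
    rewrite ?lift_perm_lift ?perm1 ?lift_ltn ?lift_max /= ?ltnn ?orbF //.
  - by move=> /andP[].
  - by case: (ltnP j' n).
  - by rewrite ltnNge (ltnW (ltn_ord k')).
move=> s shs; have [t st] := lift_perm_surj ord_max s; rewrite [RHS]st.
congr lift_perm; apply/eqP; rewrite eq_sym -shuffle_all.
apply/forallP=> j; apply/forallP=> k.
move/forallP/(_ (lift ord_max j))/forallP/(_ (lift ord_max k)): shs.
by rewrite st !lift_perm_lift !lift_ltn !lift_max !ltn_ord.
Qed.

Lemma sum_shuffle_cons (M : nmodType) n (F : 'S_n.+1 -> M) :
  \sum_(s | shuffle 1 s) F s = \sum_(i < n.+1) F (lift_perm ord0 i 1%g).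
Proof.
rewrite (reindex_onto (fun i => lift_perm ord0 i 1%g) (fun s => s ord0)) /=.
  apply: eq_bigl => i; rewrite lift_perm_id eqxx andbT; apply/forallP=> j.
  apply/forallP=> k; apply/implyP.
  case: (unliftP ord0 j) => [j' ->|->]; case: (unliftP ord0 k) => [k' ->|->] //=;
    rewrite ?lift_perm_lift ?perm1 ?lift_ltn //.
  by move=> /andP[].
move=> s shs; have [t st] := lift_perm_surj ord0 s; rewrite [RHS]st.
congr lift_perm; apply/eqP; rewrite eq_sym -shuffle_none.
apply/forallP=> j; apply/forallP=> k.
move/forallP/(_ (lift ord0 j))/forallP/(_ (lift ord0 k)): shs.
by rewrite st !lift_perm_lift !lift_ltn.
Qed.

(** * Values of the Nijenhuis-Richardson product in low arities *)

Lemma lift_perm1_cons n (i k : 'I_n.+1) :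
  lift_perm ord0 i 1 k = (if k == 0 :> nat then i : nat else bump i k.-1) :> nat.
Proof.
by case: (unliftP ord0 k) => [k' ->|->]; rewrite ?lift_perm_lift ?perm1 ?lift_perm_id.
Qed.

Lemma lift_perm1_rcons n (i k : 'I_n.+1) :
  lift_perm ord_max i 1 k = (if k == n :> nat then i : nat else bump i k) :> nat.
Proof.
case: (unliftP ord_max k) => [k' ->|->]; rewrite ?lift_perm_id ?eqxx //.
by rewrite lift_perm_lift perm1 lift_max (ltn_eqF (ltn_ord k')).
Qed.

(** Argument families are read through their index as a number, so that the
    value of a shuffle is needed only as a number. *)
Definition vec2 T (a b : T) (i : 'I_2) : T := nth b [:: a] i.
Definition vec3 T (a b c : T) (i : 'I_3) : T := nth c [:: a; b] i.

Lemma vec2_eta T (x : 'I_2 -> T) : x = vec2 (x ord0) (x ord_max).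
Proof. by apply/funext=> -[[|[|k]] lt_k] //; rewrite /vec2 /=; congr x; apply: val_inj. Qed.

Lemma vec3_eta T (x : 'I_3 -> T) :
  x = vec3 (x ord0) (x (inord 1)) (x ord_max).
Proof.
by apply/funext=> -[[|[|[|k]]] lt_k] //; rewrite /vec3 /=;
  congr x; apply: val_inj; rewrite /= ?inordK.
Qed.

Lemma vec1_eta T (x : 'I_1 -> T) : x = fun=> x ord0.
Proof. by apply/funext=> i; rewrite (ord1 i). Qed.

Lemma vec0_eta T (x y : 'I_0 -> T) : x = y.
Proof. by apply/funext=> -[]. Qed.

Section Nijenhuis.
Variables (K : fieldType) (g V : lmodType K).
Local Notation mor := (mor g V).
Implicit Types X Y Z : g * V.

Lemma circ00 (P Q : mor 1) X : @circ _ _ _ 0 0 P Q (fun=> X) = P (fun=> Q (fun=> X)).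
Proof.
rewrite /circ sum_shuffle_all odd_perm1 expr0 scale1r.
by congr P; apply/funext=> i; rewrite (ord1 i).
Qed.

Lemma circ10 (P : mor 2) (Q : mor 1) X Y :
  @circ _ _ _ 1 0 P Q (vec2 X Y) =
    P (vec2 (Q (fun=> X)) Y) - P (vec2 (Q (fun=> Y)) X).
Proof.
rewrite /circ sum_shuffle_cons big_ord_recl big_ord1 !odd_lift_perm !odd_perm1 /=.
rewrite expr0 expr1 scale1r scaleN1r.
congr (P _ - P _); apply/funext=> -[[|[|k]] lt_k] //=;
  rewrite /vec2 ?add0n /=; try (congr Q; apply/funext => j);
  rewrite lift_perm1_cons ?(ord1 j) ?inordK //.
Qed.

Lemma circ01 (P : mor 1) (Q : mor 2) X Y :
  @circ _ _ _ 0 1 P Q (vec2 X Y) = P (fun=> Q (vec2 X Y)).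
Proof.
rewrite /circ sum_shuffle_all odd_perm1 expr0 scale1r; congr P; apply/funext=> i.
rewrite (ord1 i) /=; congr Q; apply/funext=> j; rewrite perm1.
by rewrite /vec2 inordK.
Qed.

Lemma circ11 (P Q : mor 2) X Y Z :
  @circ _ _ _ 1 1 P Q (vec3 X Y Z) =
    P (vec2 (Q (vec2 X Y)) Z) - P (vec2 (Q (vec2 X Z)) Y)
      + P (vec2 (Q (vec2 Y Z)) X).
Proof.
rewrite /circ sum_shuffle_rcons !big_ord_recl big_ord0 !odd_lift_perm !odd_perm1 /=.
rewrite /= !expr0 expr1 !scale1r scaleN1r addr0.
rewrite [RHS]addrC [X in _ = _ + X]addrC.
congr (P _ + (- P _ + P _)); apply/funext=> -[[|[|k]] lt_k] //=;
  rewrite /vec2 /vec3 /=; try (congr Q; apply/funext => -[[|[|j]] lt_j]) => //=;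
  rewrite lift_perm1_rcons ?inordK //.
Qed.
End Nijenhuis.

(** * Linear and bilinear maps *)

Section Linear.
Variables (R : comNzRingType) (U W : lmodType R).
Variables (f : U -> W) (lin_f : linear f).
Let F : {linear U -> W} := HB.pack f (GRing.isLinear.Build R U W *:%R f lin_f).

Lemma lin0 : f 0 = 0. Proof. exact: (linear0 F). Qed.
Lemma linN u : f (- u) = - f u. Proof. exact: (linearN F). Qed.
Lemma linD u v : f (u + v) = f u + f v. Proof. exact: (linearD F). Qed.
Lemma linZ a u : f (a *: u) = a *: f u. Proof. exact: (linearZ_LR F). Qed.

Definition linE := (lin0, linN, linD).
End Linear.

Section Bilinear.
Variables (R : comNzRingType) (U U' W : lmodType R).
Variables (b : U -> U' -> W) (bil_b : bilinear_for *:%R *:%R b).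

Lemma bil_linl v : linear (b^~ v). Proof. by case: bil_b => bl _ a x y; apply: bl. Qed.
Lemma bil_linr u : linear (b u). Proof. by case: bil_b => _ br a x y; apply: br. Qed.

Lemma bil0l v : b 0 v = 0. Proof. exact: (lin0 (bil_linl v)). Qed.
Lemma bil0r u : b u 0 = 0. Proof. exact: (lin0 (bil_linr u)). Qed.
Lemma bilNl u v : b (- u) v = - b u v. Proof. exact: (linN (bil_linl v)). Qed.
Lemma bilNr u v : b u (- v) = - b u v. Proof. exact: (linN (bil_linr u)). Qed.
Lemma bilDl u u' v : b (u + u') v = b u v + b u' v.
Proof. exact: (linD (bil_linl v)). Qed.
Lemma bilDr u v v' : b u (v + v') = b u v + b u v'.
Proof. exact: (linD (bil_linr u)). Qed.
Lemma bilZl a u v : b (a *: u) v = a *: b u v.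
Proof. exact: (linZ (bil_linl v)). Qed.
Lemma bilZr a u v : b u (a *: v) = a *: b u v.
Proof. exact: (linZ (bil_linr u)). Qed.

Definition bilE := (bil0l, bil0r, bilNl, bilNr, bilDl, bilDr).
End Bilinear.

Lemma alt_anti (R : comNzRingType) (U W : lmodType R) (b : U -> U -> W) :
    bilinear_for *:%R *:%R b -> (forall x, b x x = 0) ->
  forall x y, b x y = - b y x.
Proof.
move=> bil_b alt_b x y; apply/eqP; rewrite -addr_eq0; apply/eqP.
by move: (alt_b (x + y)); rewrite !(bilDl bil_b) !(bilDr bil_b) !alt_b add0r addr0.
Qed.

(** * First-order parts *)

Section FirstOrder.
Variables (K : fieldType) (g V : lmodType K).

Record first_order_multilinear (w : g -> g -> g) (s : g -> V -> V) (th : V -> g) : Prop :=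
  FirstOrderMultilinear {
  fo_bilinear : bilinear_for *:%R *:%R w;
  fo_alt : forall x, w x x = 0;
  fo_act_bilinear : bilinear_for *:%R *:%R s;
  fo_linear : linear th
}.

Variable A : relRB g V.

(** The coefficients of t in the Jacobi identity for [brk A + t w], in the
    representation identity for [act A + t s] and in the Rota-Baxter identity
    for [rbo A + t th]. *)
Record first_order_eqns (w : g -> g -> g) (s : g -> V -> V) (th : V -> g) : Prop :=
  FirstOrderEqns {
  fo_jacobi : forall x y z,
    (brk A x (w y z) + w x (brk A y z)) + (brk A y (w z x) + w y (brk A z x))
      + (brk A z (w x y) + w z (brk A x y)) = 0;
  fo_act_brk : forall x y v,
    act A (w x y) v + s (brk A x y) v =
      (act A x (s y v) + s x (act A y v)) - (act A y (s x v) + s y (act A x v));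
  fo_RB : forall u v,
    brk A (rbo A u) (th v) + brk A (th u) (rbo A v) + w (rbo A u) (rbo A v) =
      rbo A ((act A (th u) v + s (rbo A u) v) - (act A (th v) u + s (rbo A v) u))
        + th (act A (rbo A u) v - act A (rbo A v) u)
}.

(** The effect of Id + t N and Id + t S on first-order parts: the primed structure
    is the unprimed one transported along them. *)
Definition gauge_shift (N : g -> g) (S : V -> V) w s th w' s' th' : Prop :=
  [/\ forall x y, w' x y - w x y = brk A (N x) y + brk A x (N y) - N (brk A x y),
      forall x v, s' x v - s x v = act A (N x) v + act A x (S v) - S (act A x v)
    & forall v, th' v - th v = rbo A (S v) - N (rbo A v)].
End FirstOrder.

(** * Cochains in degrees 1 and 2 *)

Section Cochains.
Variables (K : fieldType) (g V : lmodType K).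
Implicit Types X Y Z : g * V.

Definition cochain_brk (c : cochainS g V 1) x y : g := coch_g c (vec2 x y) (fun=> 0).
Definition cochain_act (c : cochainS g V 1) x v : V := coch_V c (fun=> x) (fun=> v).
Definition cochain_rbo (c : cochainS g V 1) v : g := coch_T c (fun=> 0) (fun=> v).

Lemma castmor_id n (e : n = n) (f : mor g V n) : castmor e f = f.
Proof.
rewrite /castmor; apply/funext=> x; apply: (congr1 f); apply/funext=> i /=.
by apply: (congr1 x); apply: val_inj.
Qed.

Lemma hat20 (U : lmodType K) (f : ('I_2 -> g) -> ('I_0 -> V) -> U) X Y :
  @hat _ _ _ 2 0 U f (vec2 X Y) = f (vec2 X.1 Y.1) (fun=> 0).
Proof.
rewrite /hat sum_shuffle_all odd_perm1 expr0 scale1r.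
congr f; last exact: vec0_eta.
apply/funext=> i; rewrite perm1 /vec2 /=.
by case: i => [[|[|i]]].
Qed.

Lemma hat11 (U : lmodType K) (f : ('I_1 -> g) -> ('I_1 -> V) -> U) X Y :
  @hat _ _ _ 1 1 U f (vec2 X Y) =
    f (fun=> X.1) (fun=> Y.2) - f (fun=> Y.1) (fun=> X.2).
Proof.
rewrite /hat sum_shuffle_cons big_ord_recl big_ord1 !odd_lift_perm !odd_perm1 /=.
rewrite expr0 expr1 scale1r scaleN1r.
by congr (f _ _ - f _ _); apply/funext=> i; rewrite (ord1 i) /vec2 lift_perm1_cons.
Qed.

Lemma hat01 (U : lmodType K) (f : ('I_0 -> g) -> ('I_1 -> V) -> U) X :
  @hat _ _ _ 0 1 U f (fun=> X) = f (fun=> 0) (fun=> X.2).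
Proof.
rewrite /hat sum_shuffle_none odd_perm1 expr0 scale1r.
by congr f; apply: vec0_eta.
Qed.

Lemma hat10 (U : lmodType K) (f : ('I_1 -> g) -> ('I_0 -> V) -> U) X :
  @hat _ _ _ 1 0 U f (fun=> X) = f (fun=> X.1) (fun=> 0).
Proof.
rewrite /hat sum_shuffle_all odd_perm1 expr0 scale1r.
by congr f; apply: vec0_eta.
Qed.

(** The operation on the direct sum of g and V that the hats of a bracket and of an
    action add up to. *)
Definition semidirect (w : g -> g -> g) (s : g -> V -> V) X Y : g * V :=
  (w X.1 Y.1, s X.1 Y.2 - s Y.1 X.2).

Lemma lift_f_vec2 (c : cochainS g V 1) X Y :
  lift_f c (vec2 X Y) = semidirect (cochain_brk c) (cochain_act c) X Y.
Proof.
rewrite /lift_f !castmor_id.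
transitivity (@hat _ _ _ 2 0 g (coch_g c) (vec2 X Y) + 0,
              0 + @hat _ _ _ 1 1 V (coch_V c) (vec2 X Y)) => //.
by rewrite hat20 hat11 add0r addr0.
Qed.

Lemma lift_f_vec1 (c : cochainS g V 0) X :
  lift_f c (fun=> X) =
    (coch_g c (fun=> X.1) (fun=> 0), coch_V c (fun=> 0) (fun=> X.2)).
Proof.
rewrite /lift_f !castmor_id.
transitivity (@hat _ _ _ 1 0 g (coch_g c) (fun=> X) + 0,
              0 + @hat _ _ _ 0 1 V (coch_V c) (fun=> X)) => //.
by rewrite hat10 hat01 add0r addr0.
Qed.

Lemma lift_theta_vec1 (c : cochainS g V 1) X :
  lift_theta c (fun=> X) = (cochain_rbo c X.2, 0).
Proof. by rewrite /lift_theta /hat_g hat01. Qed.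

Variable A : relRB g V.

Lemma pi_hat_vec2 X Y : pi_hat A (vec2 X Y) = semidirect (brk A) (act A) X Y.
Proof.
transitivity (@hat _ _ _ 2 0 g (fun x _ => brk A (x ord0) (x ord_max)) (vec2 X Y) + 0,
              0 + @hat _ _ _ 1 1 V (fun x v => act A (x ord0) (v ord0)) (vec2 X Y)) => //.
by rewrite hat20 hat11 add0r addr0.
Qed.

Lemma T_hat_vec1 X : T_hat A (fun=> X) = (rbo A X.2, 0).
Proof. by rewrite /T_hat /hat_g hat01. Qed.

Lemma nr00 (P Q : mor g V 1) X :
  @nr _ _ _ 0 0 P Q (fun=> X) = P (fun=> Q (fun=> X)) - Q (fun=> P (fun=> X)).
Proof.
rewrite /nr expr0 scale1r castmor_id.
transitivity (@circ _ _ _ 0 0 P Q (fun=> X) - @circ _ _ _ 0 0 Q P (fun=> X)) => //.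
by rewrite !circ00.
Qed.

Lemma nr10 (P : mor g V 2) (Q : mor g V 1) X Y :
  @nr _ _ _ 1 0 P Q (vec2 X Y) =
    P (vec2 (Q (fun=> X)) Y) - P (vec2 (Q (fun=> Y)) X) - Q (fun=> P (vec2 X Y)).
Proof.
rewrite /nr expr0 scale1r castmor_id.
transitivity (@circ _ _ _ 1 0 P Q (vec2 X Y) - @circ _ _ _ 0 1 Q P (vec2 X Y)) => //.
by rewrite circ10 circ01.
Qed.

Lemma nr11 (P Q : mor g V 2) X Y Z :
  @nr _ _ _ 1 1 P Q (vec3 X Y Z) =
    (P (vec2 (Q (vec2 X Y)) Z) - P (vec2 (Q (vec2 X Z)) Y)
      + P (vec2 (Q (vec2 Y Z)) X)) +
    (Q (vec2 (P (vec2 X Y)) Z) - Q (vec2 (P (vec2 X Z)) Y)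
      + Q (vec2 (P (vec2 Y Z)) X)).
Proof.
rewrite /nr expr1 scaleN1r opprK castmor_id.
transitivity (@circ _ _ _ 1 1 P Q (vec3 X Y Z) + @circ _ _ _ 1 1 Q P (vec3 X Y Z)) => //.
by rewrite !circ11.
Qed.

Lemma nr_T_vec2 (P : mor g V 2) X Y :
  nr_T A P (vec2 X Y) =
    P (vec2 (rbo A X.2, 0) Y) - P (vec2 (rbo A Y.2, 0) X)
      - (rbo A (P (vec2 X Y)).2, 0).
Proof. by rewrite /nr_T castmor_id nr10 !T_hat_vec1. Qed.

Lemma altlin2_bilinear (U W : lmodType K) (f : ('I_2 -> U) -> W) :
    altlin f -> bilinear_for *:%R *:%R (fun x y => f (vec2 x y)).
Proof.
case=> lin_f _; split=> [y|x] a u v.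
  have vecE z : vec2 z y = [eta vec2 0 y with ord0 |-> z].
    by apply/funext=> -[[|[|k]] lt_k].
  by rewrite (vecE (_ + _)) (vecE u) (vecE v) lin_f.
have vecE z : vec2 x z = [eta vec2 x 0 with ord_max |-> z].
  by apply/funext=> -[[|[|k]] lt_k].
by rewrite (vecE (_ + _)) (vecE u) (vecE v) lin_f.
Qed.

Lemma altlin1_linear (U W : lmodType K) (f : ('I_1 -> U) -> W) :
  altlin f -> linear (fun x => f (fun=> x)).
Proof.
case=> lin_f _ a u v.
have vecE z : (fun=> z) = [eta (fun=> 0) with ord0 |-> z] :> ('I_1 -> U).
  by apply/funext=> i; rewrite (ord1 i).
by rewrite (vecE (_ + _)) (vecE u) (vecE v) lin_f.
Qed.

Lemma cochain_multilinear (c : cochainS g V 1) :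
  first_order_multilinear (cochain_brk c) (cochain_act c) (cochain_rbo c).
Proof.
case: c => cg cV cT cT1; split.
- exact: (@altlin2_bilinear _ _ (cg^~ (fun=> 0)) (alt_funl cg _)).
- move=> x; case: (alt_funl cg (fun=> 0)) => _ alt_cg.
  exact: (alt_cg _ ord0 ord_max).
- split=> [v|x].
    exact: (@altlin1_linear _ _ (cV^~ (fun=> v)) (alt_funl cV _)).
  exact: (@altlin1_linear _ _ (cV (fun=> x)) (alt_funr cV _)).
- exact: (@altlin1_linear _ _ (cT (fun=> 0)) (alt_funr cT _)).
Qed.

(** On g the bracket is minus the polarised Jacobiator. On V each of the three
    arguments contributes the defect of the polarised representation identity
    at it, for the two others taken as elements of g. *)
Lemma nr_pi_semidirect (P Q : mor g V 2) (b : g -> g -> g) r w s X Y Z :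
    (forall X Y, P (vec2 X Y) = semidirect b r X Y) ->
    (forall X Y, Q (vec2 X Y) = semidirect w s X Y) ->
    bilinear_for *:%R *:%R b -> bilinear_for *:%R *:%R r ->
    bilinear_for *:%R *:%R w -> bilinear_for *:%R *:%R s ->
    (forall x, b x x = 0) -> (forall x, w x x = 0) ->
  let rep x y v := r (w x y) v + s (b x y) v - (r x (s y v) + s x (r y v))
                    + (r y (s x v) + s y (r x v)) in
  @nr _ _ _ 1 1 P Q (vec3 X Y Z) =
    (- ((b X.1 (w Y.1 Z.1) + w X.1 (b Y.1 Z.1))
        + (b Y.1 (w Z.1 X.1) + w Y.1 (b Z.1 X.1))
        + (b Z.1 (w X.1 Y.1) + w Z.1 (b X.1 Y.1))),
     rep X.1 Y.1 Z.2 - rep X.1 Z.1 Y.2 + rep Y.1 Z.1 X.2).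
Proof.
move=> PE QE bilb bilr bilw bils altb altw rep.
rewrite nr11 !PE !QE /semidirect /=; case: X Y Z => [x u] [y v] [z t] /=.
rewrite /rep; congr (_, _) => /=.
  (* All brackets are oriented alike before the atoms are compared. *)
  rewrite !(alt_anti bilb altb _ (w _ _)) !(alt_anti bilw altw _ (b _ _)).
  rewrite !(alt_anti bilb altb z x) !(alt_anti bilw altw z x).
  by rewrite !(bilE bilb) !(bilE bilw); zmod.
by rewrite !(bilE bilr) !(bilE bils); zmod.
Qed.
Lemma nr_pi_lift_f (c : cochainS g V 1) X Y Z
    (w := cochain_brk c) (s := cochain_act c) :
  let rep x y v := act A (w x y) v + s (brk A x y) v
    - (act A x (s y v) + s x (act A y v)) + (act A y (s x v) + s y (act A x v)) in
  @nr _ _ _ 1 1 (pi_hat A) (lift_f c) (vec3 X Y Z) =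
    (- ((brk A X.1 (w Y.1 Z.1) + w X.1 (brk A Y.1 Z.1))
        + (brk A Y.1 (w Z.1 X.1) + w Y.1 (brk A Z.1 X.1))
        + (brk A Z.1 (w X.1 Y.1) + w Z.1 (brk A X.1 Y.1))),
     rep X.1 Y.1 Z.2 - rep X.1 Z.1 Y.2 + rep Y.1 Z.1 X.2).
Proof.
case: (cochain_multilinear c) => bilw altw bils _.
apply: (nr_pi_semidirect _ _ _ pi_hat_vec2 (lift_f_vec2 c)) => //.
- exact: brk_bilinear.
- exact: act_bilinear.
- exact: brk_alt.
Qed.

(** Since T vanishes on g and takes its values there, T T = 0, and of the terms
    of the double bracket of f with T the distinct ones survive twice each; half
    of it is the expression k of the proof. *)
Lemma coboundary_snd (two_neq0 : 2%:R != 0 :> K) (c : cochainS g V 1) X Y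
    (w := cochain_brk c) (s := cochain_act c) (th := cochain_rbo c) :
  (nr_piT A (lift_theta c) + 2%:R^-1 *: iter 2 (@nr_T _ _ _ A 1) (lift_f c)) (vec2 X Y) =
    (brk A (rbo A X.2) (th Y.2) + brk A (th X.2) (rbo A Y.2)
       + w (rbo A X.2) (rbo A Y.2)
     - (rbo A ((act A (th X.2) Y.2 + s (rbo A X.2) Y.2)
               - (act A (th Y.2) X.2 + s (rbo A Y.2) X.2))
        + th (act A (rbo A X.2) Y.2 - act A (rbo A Y.2) X.2)), 0).
Proof.
have bilb := brk_bilinear A; have bilr := act_bilinear A; have linT := rbo_linear A.
case: (cochain_multilinear c); rewrite -/w -/s -/th => bilw altw bils linth.
transitivity (nr_piT A (lift_theta c) (vec2 X Y)
  + 2%:R^-1 *: nr_T A (nr_T A (lift_f c)) (vec2 X Y)) => //.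
rewrite !nr_T_vec2 !lift_f_vec2 /nr_piT nr10 !lift_theta_vec1 !nr10 !T_hat_vec1 !pi_hat_vec2.
rewrite /semidirect -/w -/s -/th.
case: X Y => [x u] [y v] /=.
pose k := w (rbo A u) (rbo A v) - rbo A (s (rbo A u) v) + rbo A (s (rbo A v) u).
transitivity ((brk A (rbo A u) (th v) + brk A (th u) (rbo A v)
   - rbo A (act A (th u) v - act A (th v) u)
   - th (act A (rbo A u) v - act A (rbo A v) u), 0 : V)
  + 2%:R^-1 *: (k + k, 0 : V)).
  congr (_ + _ *: _).
    congr (_, _) => /=.
      rewrite !(alt_anti bilb (brk_alt A) (rbo A v)).
      by rewrite !(bilE bilb, bilE bilr, linE linT, linE linth); zmod.
    by rewrite !(bilE bilb, bilE bilr, linE linT, linE linth); zmod.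
  congr (_, _) => /=; rewrite /k.
    rewrite !(alt_anti bilw altw (rbo A v)).
    by rewrite !(bilE bilw, bilE bils, linE linT, linE linth); zmod.
  by rewrite !(bilE bilw, bilE bils, linE linT, linE linth); zmod.
have half_k : 2%:R^-1 *: (k + k) = k.
  by rewrite -mulr2n -scaler_nat scalerA mulVf // scale1r.
congr (_, _); last by rewrite /= scaler0 addr0.
rewrite [LHS]/= half_k /k.
by rewrite !(linE linT, linE linth); zmod.
Qed.
(** Evaluation at elements of g or V isolates the single equations; conversely all
    components of the coboundary are combinations of their defects. *)
Lemma cocycleP (two_neq0 : 2%:R != 0 :> K) (c : cochain g V 2) :
  coboundary A c = 0 <->
    first_order_eqns A (cochain_brk c) (cochain_act c) (cochain_rbo c).
Proof.
have bilb := brk_bilinear A; have bilr := act_bilinear A; have linT := rbo_linear A.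
case: (cochain_multilinear c) => bilw altw bils linth.
have -> : coboundary A c = (- @nr _ _ _ 1 1 (pi_hat A) (lift_f c),
    nr_piT A (lift_theta c) + 2%:R^-1 *: iter 2 (@nr_T _ _ _ A 1) (lift_f c)).
  by rewrite /coboundary /coboundaryS sqrrN expr1n scale1r.
split=> [[/(congr1 -%R)]|[jac rep RB]].
  rewrite opprK oppr0 => nr0 snd0; split=> [x y z|x y v|u v].
  - have := congr1 (fun p => p.1) (congr1 (@^~ (vec3 (x, 0) (y, 0) (z, 0))) nr0).
    by rewrite nr_pi_lift_f => /eqP; rewrite oppr_eq0 => /eqP.
  - have := congr1 (fun p => p.2) (congr1 (@^~ (vec3 (x, 0) (y, 0) (0, v))) nr0).
    rewrite nr_pi_lift_f /= !(bilE bilr, bilE bils) => rep0.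
    by apply: (eq_from_sub rep0); zmod.
  have := congr1 (fun p => p.1) (congr1 (@^~ (vec2 (0, u) (0, v))) snd0).
  by rewrite coboundary_snd //= => /subr0_eq.
congr (_, _); apply/funext=> X.
  rewrite (vec3_eta X); apply/eqP; rewrite oppr_eq0; apply/eqP.
  rewrite nr_pi_lift_f jac oppr0; congr (_, _).
  by rewrite !rep; zmod.
by rewrite (vec2_eta X) coboundary_snd // RB subrr.
Qed.

Lemma altlin0 (U W : lmodType K) (f : ('I_0 -> U) -> W) : altlin f.
Proof. by split=> [x|x] []. Qed.

Lemma altlin_linear (U W : lmodType K) (f : U -> W) :
  linear f -> altlin (fun x : 'I_1 -> U => f (x ord0)).
Proof.
move=> lin_f; split=> [x i a u v|x i j]; rewrite (ord1 i) ?(ord1 j) //.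
exact: lin_f.
Qed.

Lemma ord2_cases (i : 'I_2) : i = ord0 \/ i = ord_max.
Proof. by case: i => [[|[|i]] lt_i] //; [left|right]; apply: val_inj. Qed.

Lemma altlin_bilinear (U W : lmodType K) (b : U -> U -> W) :
    bilinear_for *:%R *:%R b -> (forall x, b x x = 0) ->
  altlin (fun x : 'I_2 -> U => b (x ord0) (x ord_max)).
Proof.
move=> bil_b alt_b; split=> [x i a u v|x i j].
  have [->|->] := ord2_cases i; first by rewrite /= (bilDl bil_b) (bilZl bil_b).
  by rewrite /= (bilDr bil_b) (bilZr bil_b).
by have [->|->] := ord2_cases i; have [->|->] := ord2_cases j; rewrite ?eqxx // => _ ->.
Qed.

Lemma cochain2_exists w s th : first_order_multilinear w s th ->
  exists c : cochainS g V 1,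
    [/\ cochain_brk c = w, cochain_act c = s & cochain_rbo c = th].
Proof.
case=> bilw altw bils linth.
pose cg := AltHom (fun v : 'I_0 -> V => altlin_bilinear bilw altw)
  (fun x => @altlin0 V g (fun=> w (x ord0) (x ord_max))).
pose cV := AltHom (fun v : 'I_1 -> V => altlin_linear (bil_linl bils (v ord0)))
  (fun x : 'I_1 -> g => altlin_linear (bil_linr bils (x ord0))).
pose cT := AltHom (fun v : 'I_1 -> V => @altlin0 g g (fun=> th (v ord0)))
  (fun x : 'I_0 -> g => altlin_linear linth).
by exists (@CochainS K g V 1 cg cV cT (fun e => ltac:(discriminate))).
Qed.

Lemma cochain1_exists N S : linear N -> linear S ->
  exists c : cochainS g V 0, forall X, lift_f c (fun=> X) = (N X.1, S X.2).
Proof.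
move=> linN linS.
pose cg := AltHom (fun v : 'I_0 -> V => altlin_linear linN)
  (fun x => @altlin0 V g (fun=> N (x ord0))).
pose cV := AltHom (fun v : 'I_1 -> V => @altlin0 g V (fun=> S (v ord0)))
  (fun x : 'I_0 -> g => altlin_linear linS).
pose cT := AltHom (fun v : 'I_0 -> V => @altlin0 g g (fun=> 0))
  (fun x => @altlin0 V g (fun=> 0)).
exists (@CochainS K g V 0 cg cV cT (fun _ _ _ => erefl)) => X.
by rewrite lift_f_vec1.
Qed.

Lemma cochain1_linear (c : cochainS g V 0) :
  exists N S, [/\ linear N, linear S & forall X, lift_f c (fun=> X) = (N X.1, S X.2)].
Proof.
exists (fun x => coch_g c (fun=> x) (fun=> 0)), (fun v => coch_V c (fun=> 0) (fun=> v)).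
split=> [||X]; last exact: lift_f_vec1.
- exact: (@altlin1_linear _ _ ((coch_g c)^~ (fun=> 0)) (alt_funl (coch_g c) _)).
- exact: (@altlin1_linear _ _ (coch_V c (fun=> 0)) (alt_funr (coch_V c) _)).
Qed.

(** In degree 1 the coboundary of (N, S) is [pi, (N, S)] on the first component and
    minus [(N, S), T] on the second. *)
Lemma coboundary1P (c c' : cochainS g V 1) (b : cochainS g V 0) N S :
    linear N -> linear S -> (forall X, lift_f b (fun=> X) = (N X.1, S X.2)) ->
  (@Defs.lift _ _ _ 2 c' - @Defs.lift _ _ _ 2 c = @coboundary _ _ _ A 1 b) <->
  gauge_shift A N S (cochain_brk c) (cochain_act c) (cochain_rbo c)
    (cochain_brk c') (cochain_act c') (cochain_rbo c').
Proof.
move=> linN linS bE.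
have bilb := brk_bilinear A; have bilr := act_bilinear A; have linT := rbo_linear A.
case: (cochain_multilinear c) => bilw altw bils linth.
case: (cochain_multilinear c') => bilw' altw' bils' linth'.
(* The outer sign is the (-1)^n of the differential, here with n = 1. *)
have fstE X Y : (- (- @nr _ _ _ 1 0 (pi_hat A) (lift_f b))) (vec2 X Y) =
   (brk A (N X.1) Y.1 + brk A X.1 (N Y.1) - N (brk A X.1 Y.1),
    (act A (N X.1) Y.2 + act A X.1 (S Y.2) - S (act A X.1 Y.2))
     - (act A (N Y.1) X.2 + act A Y.1 (S X.2) - S (act A Y.1 X.2))).
  rewrite opprK nr10 !bE !pi_hat_vec2 /semidirect; congr (_, _) => /=.
    by rewrite (alt_anti bilb (brk_alt A) (N Y.1)); zmod.
  by rewrite !(linE linS); zmod.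
have sndE X : (- (0 + (1`!)%:R^-1 *: @nr_T _ _ _ A 0 (lift_f b))) (fun=> X) =
    (rbo A (S X.2) - N (rbo A X.2), 0).
  rewrite invr1 scale1r add0r /nr_T castmor_id.
  transitivity (- (@nr _ _ _ 0 0 (lift_f b) (T_hat A) (fun=> X))) => //.
  rewrite nr00 !bE !T_hat_vec1; congr (_, _); rewrite /= ?(linE linS); zmod.
have -> : @coboundary _ _ _ A 1 b = (- - @nr _ _ _ 1 0 (pi_hat A) (lift_f b),
    - (0 + (1`!)%:R^-1 *: @nr_T _ _ _ A 0 (lift_f b))).
  by rewrite /coboundary /coboundaryS expr1 scaleN1r.
have liftE X Y : (lift_f c' - lift_f c) (vec2 X Y) =
    semidirect (cochain_brk c') (cochain_act c') X Y
     - semidirect (cochain_brk c) (cochain_act c) X Y.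
  by rewrite -!lift_f_vec2.
have thE X : (lift_theta c' - lift_theta c) (fun=> X) =
    (cochain_rbo c' X.2 - cochain_rbo c X.2, 0).
  transitivity (lift_theta c' (fun=> X) - lift_theta c (fun=> X)) => //.
  by rewrite !lift_theta_vec1; congr (_, _); rewrite /= subr0.
split=> [[f_eq th_eq]|[wE sE tE]].
  split=> [x y|x v|v].
  - have := congr1 (fun p => p.1) (congr1 (@^~ (vec2 (x, 0) (y, 0))) f_eq).
    by rewrite liftE fstE.
  - have := congr1 (fun p => p.2) (congr1 (@^~ (vec2 (x, 0) (0, v))) f_eq).
    rewrite liftE fstE /= !(bilE bilr, bilE bils, bilE bils', linE linN, linE linS).
    by move=> eq_v; apply: (eq_from_sub eq_v); zmod.
  - have := congr1 (fun p => p.1) (congr1 (@^~ (fun=> (0, v))) th_eq).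
    by rewrite thE sndE.
congr (_, _); apply/funext=> X.
  rewrite (vec2_eta X) liftE fstE -!wE -!sE; congr (_, _) => /=.
  by zmod.
by rewrite (vec1_eta X) thE sndE tE.
Qed.
End Cochains.

(** * Maps over the dual numbers *)

Section DualLinear.
Variables (K : fieldType) (U W : lmodType K).

(** The map f0 + t f1 extended to the tensor product. *)
Definition deform (f0 f1 : U -> W) (z : dtens U) : dtens W :=
  (f0 z.1, f0 z.2 + f1 z.1).

Definition eps_coef (f : dtens U -> dtens W) (x : U) : W := (f (x, 0)).2.

Lemma eps_exists : {e : dual K | aug e = 0 /\ eps_part e = 1}.
Proof.
exists (in_qpoly 'X^2 'X); rewrite /aug /eps_part.
have -> : in_qpoly 'X^2 'X = 'X :> {poly K}.
  by apply: qpolyXE; rewrite ?size_polyXn ?monicXn.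
by rewrite !coefX.
Qed.

Lemma const_exists (a : K) : {r : dual K | aug r = a /\ eps_part r = 0}.
Proof.
exists (a *: 1).
by rewrite /aug /eps_part /= !coefZ !coefC /= mulr1 mulr0.
Qed.

Lemma deform_linear f0 f1 : linear f0 -> linear f1 -> linear (deform f0 f1).
Proof.
move=> lin0 lin1 r z z'; congr (_, _); first exact: lin0.
rewrite /= !(linD lin0) !(linZ lin0) (linD lin1) (linZ lin1) scalerDr.
by zmod.
Qed.

(** Writing z = z0 + t z1, the term t f(z1) depends only on f modulo t, as t
    annihilates the multiples of t. *)
Lemma linear_deform (f : dtens U -> dtens W) (f0 : U -> W) :
    linear f -> (forall z, (f z).1 = f0 z.1) ->
  f = deform f0 (eps_coef f).
Proof.
move=> lin_f fE; have [e [aug_e eps_e]] := eps_exists.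
apply/funext=> z.
have zE : z = e *: ((z.2, 0) : dtens U) + ((z.1, 0) : dtens U).
  case: z => x y; congr (_, _) => /=; first by rewrite aug_e scale0r add0r.
  by rewrite aug_e eps_e scaler0 scale1r add0r addr0.
rewrite [in LHS]zE (lin_f e (z.2, 0) (z.1, 0)); congr (_, _) => /=.
  by rewrite aug_e scale0r add0r fE.
by rewrite aug_e eps_e scale0r add0r scale1r fE.
Qed.

Lemma eps_coef_linear (f : dtens U -> dtens W) : linear f -> linear (eps_coef f).
Proof.
move=> lin_f a u v; have [r [aug_r eps_r]] := const_exists a.
rewrite /eps_coef.
have -> : ((a *: u + v, 0) : dtens U) = r *: ((u, 0) : dtens U) + ((v, 0) : dtens U).
  by congr (_, _); rewrite /= ?aug_r // eps_r scale0r scaler0 !addr0.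
by rewrite (lin_f r (u, 0) (v, 0)) /= aug_r eps_r scale0r addr0.
Qed.
End DualLinear.

Section DualBilinear.
Variables (K : fieldType) (U U' W : lmodType K).

(** The map b0 + t b1 extended to the tensor products. *)
Definition deform2 (b0 b1 : U -> U' -> W) (x : dtens U) (y : dtens U') : dtens W :=
  (b0 x.1 y.1, b0 x.1 y.2 + b0 x.2 y.1 + b1 x.1 y.1).

Definition eps_coef2 (b : dtens U -> dtens U' -> dtens W) x y : W :=
  (b (x, 0) (y, 0)).2.

Lemma deform2_bilinear b0 b1 :
    bilinear_for *:%R *:%R b0 -> bilinear_for *:%R *:%R b1 ->
  bilinear_for *:%R *:%R (deform2 b0 b1).
Proof.
move=> bil0 bil1; split=> [y|x].
  suff -> : deform2 b0 b1 ^~ y = deform (b0^~ y.1) (fun x => b0 x y.2 + b1 x y.1).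
    apply: deform_linear; first exact: bil_linl.
    move=> a u v; rewrite (bilDl bil0) (bilDl bil1) (bilZl bil0) (bilZl bil1).
    by rewrite scalerDr; zmod.
  by apply/funext=> x; congr (_, _); zmod.
suff -> : deform2 b0 b1 x = deform (b0 x.1) (fun y => b0 x.2 y + b1 x.1 y).
  apply: deform_linear; first exact: bil_linr.
  move=> a u v; rewrite !(bilDr bil0) (bilDr bil1) (bilZr bil0) (bilZr bil1).
  by rewrite scalerDr; zmod.
by apply/funext=> y; congr (_, _); zmod.
Qed.

Lemma bilinear_deform2 (b : dtens U -> dtens U' -> dtens W) b0 :
    bilinear_for *:%R *:%R b -> (forall x y, (b x y).1 = b0 x.1 y.1) ->
  b = deform2 b0 (eps_coef2 b).
Proof.
move=> bil_b bE; apply/funext=> x; apply/funext=> y.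
have := congr1 (@^~ x) (linear_deform (f0 := b0^~ y.1) (bil_linl bil_b y) (bE^~ y)).
rewrite /= => ->; congr (_, _); rewrite /eps_coef /=.
rewrite (linear_deform (f0 := b0 x.1) (bil_linr bil_b (x.1, 0)) (bE _)) /=.
by rewrite -/(eps_coef2 b x.1 y.1); zmod.
Qed.

Lemma eps_coef2_bilinear (b : dtens U -> dtens U' -> dtens W) :
  bilinear_for *:%R *:%R b -> bilinear_for *:%R *:%R (eps_coef2 b).
Proof.
move=> bil_b; split=> [y|x].
  exact: (eps_coef_linear (bil_linl bil_b (y, 0))).
exact: (eps_coef_linear (bil_linr bil_b (x, 0))).
Qed.
End DualBilinear.

(** * Infinitesimal deformations *)

Section Deformations.
Variables (K : fieldType) (g V : lmodType K) (A : relRB g V).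
Implicit Types D : deformation A.

Lemma deform_brk D : brk D = deform2 (brk A) (eps_coef2 (brk D)).
Proof. exact: bilinear_deform2 (brk_bilinear D) (hom_brk (defm_aug D)). Qed.

Lemma deform_act D : act D = deform2 (act A) (eps_coef2 (act D)).
Proof. exact: bilinear_deform2 (act_bilinear D) (hom_act (defm_aug D)). Qed.

Lemma deform_rbo D : rbo D = deform (rbo A) (eps_coef (rbo D)).
Proof.
exact: linear_deform (rbo_linear D) (fun u => esym (hom_rbo (defm_aug D) u)).
Qed.

Lemma deformation_multilinear D :
  first_order_multilinear (eps_coef2 (brk D)) (eps_coef2 (act D)) (eps_coef (rbo D)).
Proof.
split.
- exact: eps_coef2_bilinear (brk_bilinear D).
- by move=> x; rewrite /eps_coef2 brk_alt.
- exact: eps_coef2_bilinear (act_bilinear D).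
- exact: eps_coef_linear (rbo_linear D).
Qed.

Lemma deformation_eqns D :
  first_order_eqns A (eps_coef2 (brk D)) (eps_coef2 (act D)) (eps_coef (rbo D)).
Proof.
have bilb := brk_bilinear A; have bilr := act_bilinear A; have linT := rbo_linear A.
move: (brk_jacobi D) (act_brk D) (rbo_RB D) (deform_brk D) (deform_act D) (deform_rbo D).
move: (eps_coef2 (brk D)) (eps_coef2 (act D)) (eps_coef (rbo D)) => w s th.
move=> jac rep RB brkE actE rboE; split=> [x y z|x y v|u v].
- have := congr1 (fun p => p.2) (jac (x, 0) (y, 0) (z, 0)).
  by rewrite brkE /= !(bilE bilb) => e; apply: (eq_from_sub e); zmod.
- have := congr1 (fun p => p.2) (rep (x, 0) (y, 0) (v, 0)).
  by rewrite brkE actE /= !(bilE bilr, bilE bilb) => e; apply: (eq_from_sub e); zmod.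
- have := congr1 (fun p => p.2) (RB (u, 0) (v, 0)).
  rewrite brkE actE rboE /= !(bilE bilr, bilE bilb, linE linT) => e.
  by apply: (eq_from_sub e); zmod.
Qed.

(** The constant coefficient of each axiom holds in A; its coefficient of t is the
    linearised equation at the constant terms plus instances of the axiom of A
    in which one argument is replaced by its coefficient of t. *)
Lemma deformation_exists w s th :
    first_order_multilinear w s th -> first_order_eqns A w s th ->
  exists D : deformation A, [/\ eps_coef2 (brk D) = w, eps_coef2 (act D) = s
                              & eps_coef (rbo D) = th].
Proof.
case=> bilw altw bils linth [jac1 rep1 RB1].
have bilb := brk_bilinear A; have bilr := act_bilinear A; have linT := rbo_linear A.
have alt x : deform2 (brk A) w x x = 0.
  congr (_, _); first exact: brk_alt.
  by rewrite altw (alt_anti bilb (brk_alt A) x.2); zmod.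
have jac x y z : deform2 (brk A) w x (deform2 (brk A) w y z)
    + deform2 (brk A) w y (deform2 (brk A) w z x)
    + deform2 (brk A) w z (deform2 (brk A) w x y) = 0.
  congr (_, _) => /=; first exact: brk_jacobi.
  rewrite !(bilE bilb).
  apply: (eq_from_sub (jac1 x.1 y.1 z.1)).
  apply: (eq_from_sub (brk_jacobi A x.2 y.1 z.1)).
  apply: (eq_from_sub (brk_jacobi A x.1 y.2 z.1)).
  apply: (eq_from_sub (brk_jacobi A x.1 y.1 z.2)).
  by zmod.
have rep x y v : deform2 (act A) s (deform2 (brk A) w x y) v =
    deform2 (act A) s x (deform2 (act A) s y v)
     - deform2 (act A) s y (deform2 (act A) s x v).
  congr (_, _) => /=; first exact: act_brk.
  rewrite !(bilE bilr).
  apply: (eq_from_sub (rep1 x.1 y.1 v.1)).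
  rewrite !act_brk.
  by zmod.
have RB u v : deform2 (brk A) w (deform (rbo A) th u) (deform (rbo A) th v) =
    deform (rbo A) th (deform2 (act A) s (deform (rbo A) th u) v
      - deform2 (act A) s (deform (rbo A) th v) u).
  congr (_, _) => /=; first exact: rbo_RB.
  rewrite !(bilE bilr, bilE bilb).
  apply: (eq_from_sub (RB1 u.1 v.1)).
  rewrite !rbo_RB.
  rewrite !(linE linT, linE linth).
  by zmod.
pose R := RelRB (deform2_bilinear bilb bilw) alt jac (deform2_bilinear bilr bils) rep
  (deform_linear linT linth) RB.
have hom : relRB_hom R (relRB_via_aug A) aug_id aug_id by split.
exists (Deformation hom); split.
- by apply/funext=> x; apply/funext=> y; rewrite /eps_coef2 /= !(bilE bilb); zmod.
- by apply/funext=> x; apply/funext=> y; rewrite /eps_coef2 /= !(bilE bilr); zmod.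
- by apply/funext=> x; rewrite /eps_coef /= !(linE linT); zmod.
Qed.

(** An equivalence is the identity modulo t, hence of the form Id + t N, with
    inverse Id - t N. *)
Lemma deformation_equivP D D' :
  deformation_equiv D D' <->
  exists N S, [/\ linear N, linear S &
    gauge_shift A N S (eps_coef2 (brk D)) (eps_coef2 (act D)) (eps_coef (rbo D))
      (eps_coef2 (brk D')) (eps_coef2 (act D')) (eps_coef (rbo D'))].
Proof.
have bilb := brk_bilinear A; have bilr := act_bilinear A; have linT := rbo_linear A.
move: (deformation_multilinear D) (deform_brk D) (deform_act D) (deform_rbo D).
move: (deformation_multilinear D') (deform_brk D') (deform_act D') (deform_rbo D').
move: (eps_coef2 (brk D)) (eps_coef2 (act D)) (eps_coef (rbo D)) => w s th.
move: (eps_coef2 (brk D')) (eps_coef2 (act D')) (eps_coef (rbo D')) => w' s' th'.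
case=> bilw' altw' bils' linth' brkE' actE' rboE'.
case=> bilw altw bils linth brkE actE rboE.
split=> [[phi [vphi [[[lin_phi lin_vphi phi_brk phi_rbo phi_act] _ _] aug_phi aug_vphi]]]|].
  move: (linear_deform (f0 := id) lin_phi (fun z => congr1 (@^~ z) aug_phi)).
  move: (linear_deform (f0 := id) lin_vphi (fun z => congr1 (@^~ z) aug_vphi)).
  move: (eps_coef_linear lin_phi) (eps_coef_linear lin_vphi).
  move: (eps_coef phi) (eps_coef vphi) => N S linN linS vphiE phiE.
  exists N, S; split=> //; split=> [x y|x v|v].
  - have := congr1 (fun p => p.2) (phi_brk (x, 0) (y, 0)).
    rewrite phiE brkE brkE' /= !(bilE bilb) => e; apply: (eq_from_sub e); zmod.
  - have := congr1 (fun p => p.2) (phi_act (x, 0) (v, 0)).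
    rewrite phiE vphiE actE actE' /= !(bilE bilr) => e; apply: (eq_from_sub e); zmod.
  - have := congr1 (fun p => p.2) (phi_rbo (v, 0)).
    rewrite phiE vphiE rboE rboE' /= !(linE linT) => e.
    by apply: (eq_from_sub (esym e)); zmod.
move=> [N [S [linN linS [wE sE tE]]]].
have bij_deform (U : lmodType K) (f : U -> U) : bijective (deform id f).
  exists (deform id (fun x => - f x)) => z; case: z => x y; congr (_, _) => /=; zmod.
exists (deform id N), (deform id S); split=> //; split; [|exact: bij_deform..].
split=> [||x y|u|x u].
- exact: (@deform_linear _ _ _ id).
- exact: (@deform_linear _ _ _ id).
- rewrite brkE brkE'; congr (_, _); rewrite /= !(bilE bilb).
  by apply: (eq_from_sub (wE x.1 y.1)); zmod.
- rewrite rboE rboE'; congr (_, _); rewrite /= !(linE linT).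
  by apply: (eq_from_sub (esym (tE u.1))); zmod.
- rewrite actE actE'; congr (_, _); rewrite /= !(bilE bilr).
  by apply: (eq_from_sub (sE x.1 u.1)); zmod.
Qed.
End Deformations.

(** * Gauge equivalence and the correspondence *)

Record first_order_part (K : fieldType) (g V : lmodType K) := FirstOrderPart {
  part_brk : g -> g -> g;
  part_act : g -> V -> V;
  part_rbo : V -> g
}.

Section Gauge.
Variables (K : fieldType) (g V : lmodType K) (A : relRB g V).
Implicit Types p q : first_order_part g V.

Definition gauge_equiv p q : Prop :=
  exists N S, [/\ linear N, linear S
    & gauge_shift A N S (part_brk p) (part_act p) (part_rbo p)
        (part_brk q) (part_act q) (part_rbo q)].

Lemma gauge_refl p : gauge_equiv p p.
Proof.
have bilb := brk_bilinear A; have bilr := act_bilinear A; have linT := rbo_linear A.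
exists (fun=> 0), (fun=> 0); split.
- by move=> a u v; rewrite scaler0 addr0.
- by move=> a u v; rewrite scaler0 addr0.
- split=> [x y|x v|v]; rewrite ?(bil0l bilb) ?(bil0r bilb) ?(bil0l bilr) ?(bil0r bilr);
    rewrite ?(lin0 linT); zmod.
Qed.

Lemma gauge_sym p q : gauge_equiv p q -> gauge_equiv q p.
Proof.
have bilb := brk_bilinear A; have bilr := act_bilinear A; have linT := rbo_linear A.
move=> [N [S [lin_N lin_S [wE sE tE]]]].
exists (fun x => - N x), (fun v => - S v); split.
- by move=> a u v; rewrite lin_N opprD scalerN.
- by move=> a u v; rewrite lin_S opprD scalerN.
- split=> [x y|x v|v]; rewrite ?(bilNl bilb, bilNr bilb, bilNl bilr, bilNr bilr, linN linT).
  + by apply: (eq_from_sub (esym (wE x y))); zmod.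
  + by apply: (eq_from_sub (esym (sE x v))); zmod.
  + by apply: (eq_from_sub (esym (tE v))); zmod.
Qed.

Lemma gauge_trans p q r : gauge_equiv p q -> gauge_equiv q r -> gauge_equiv p r.
Proof.
have bilb := brk_bilinear A; have bilr := act_bilinear A; have linT := rbo_linear A.
move=> [N [S [lin_N lin_S [wE sE tE]]]] [N' [S' [lin_N' lin_S' [wE' sE' tE']]]].
exists (fun x => N x + N' x), (fun v => S v + S' v); split.
- by move=> a u v; rewrite lin_N lin_N' scalerDr; zmod.
- by move=> a u v; rewrite lin_S lin_S' scalerDr; zmod.
- split=> [x y|x v|v]; rewrite ?(bilDl bilb, bilDr bilb, bilDl bilr, bilDr bilr, linD linT).
  + by apply: (eq_from_sub (wE x y)); apply: (eq_from_sub (wE' x y)); zmod.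
  + by apply: (eq_from_sub (sE x v)); apply: (eq_from_sub (sE' x v)); zmod.
  + by apply: (eq_from_sub (tE v)); apply: (eq_from_sub (tE' v)); zmod.
Qed.
End Gauge.

(** A class is sent to the class of an index with the same value in T, which does
    not depend on choices up to E. Representatives have to be chosen on both
    sides, as classes are bare subsets. *)
Lemma eq_classes_bijection (T T1 T2 : Type) (E : T -> T -> Prop)
    (E1 : T1 -> T1 -> Prop) (E2 : T2 -> T2 -> Prop) (p1 : T1 -> T) (p2 : T2 -> T) :
    (forall x, E x x) -> (forall x y, E x y -> E y x) ->
    (forall x y z, E x y -> E y z -> E x z) ->
    (forall x y, E1 x y <-> E (p1 x) (p1 y)) ->
    (forall x y, E2 x y <-> E (p2 x) (p2 y)) ->
    (forall x, exists y, p2 y = p1 x) -> (forall y, exists x, p1 x = p2 y) ->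
  exists F : eq_classes E1 -> eq_classes E2, bijective F.
Proof.
move=> Erefl Esym Etrans.
have classE (U : Type) (EU : U -> U -> Prop) (p : U -> T) x y :
    (forall x y, EU x y <-> E (p x) (p y)) -> EU x = EU y <-> E (p x) (p y).
  move=> EUP; split=> [eq_xy|Exy]; first by apply/EUP; rewrite eq_xy; apply/EUP.
  apply/funext=> z; apply/propext; rewrite !EUP.
  by split; apply: Etrans => //; apply: Esym.
pose rep U (EU : U -> U -> Prop) (C : eq_classes EU) : U := sval (cid (svalP C)).
have repE U EU (C : eq_classes EU) : EU (rep U EU C) = sval C.
  exact: esym (svalP (cid (svalP C))).
pose transfer U U' (EU : U -> U -> Prop) (EU' : U' -> U' -> Prop) (h : U -> U')
    (C : eq_classes EU) : eq_classes EU' :=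
  exist _ (EU' (h (rep U EU C))) (ex_intro _ _ erefl).
have transferK U U' EU EU' h h' (p : U -> T) (p' : U' -> T) :
    (forall x y, EU x y <-> E (p x) (p y)) -> (forall x y, EU' x y <-> E (p' x) (p' y)) ->
    (forall x, p' (h x) = p x) -> (forall x, p (h' x) = p' x) ->
  cancel (transfer U U' EU EU' h) (transfer U' U EU' EU h').
  move=> EP EP' hE h'E C; apply: eq_sig_hprop => [*|]; first exact: Prop_irrelevance.
  rewrite -[RHS]repE; apply/(classE _ _ _ _ _ EP); rewrite h'E -hE.
  by apply/(classE _ _ _ _ _ EP'); rewrite repE.
move=> E1P E2P /choice[h hE] /choice[h' h'E].
by exists (transfer _ _ E1 E2 h), (transfer _ _ E2 E1 h'); apply: transferK; eauto.
Qed.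

Theorem theorem4p10 (K : fieldType) (charK : [pchar K]%R =i pred0)
    (g V : lmodType K) (A : relRB g V) :
  exists F : eq_classes (@deformation_equiv K g V A) -> cohomology A 2,
    bijective F.
Proof.
have two_neq0 : 2%:R != 0 :> K by rewrite ((pcharf0P K).1 charK 2).
pose deformation_part (D : deformation A) :=
  FirstOrderPart (eps_coef2 (brk D)) (eps_coef2 (act D)) (eps_coef (rbo D)).
pose cocycle_part (z : cocycle A 2) :=
  FirstOrderPart (cochain_brk (sval z)) (cochain_act (sval z)) (cochain_rbo (sval z)).
apply: (@eq_classes_bijection _ _ _ (gauge_equiv A) _ _ deformation_part cocycle_part).
- exact: gauge_refl.
- exact: gauge_sym.
- exact: gauge_trans.
- exact: deformation_equivP.
- move=> z w; split=> [[b /coboundary1P bE]|[N [S [linN linS NS_shift]]]].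
    have [N [S [linN linS NSE]]] := cochain1_linear b.
    by exists N, S; split=> //; apply: bE.
  have [b bE] := cochain1_exists linN linS.
  by exists b; apply/(coboundary1P _ _ _ linN linS bE).
- move=> D; have [c [wE sE tE]] := cochain2_exists (deformation_multilinear D).
  have c_cocycle : coboundary A (n := 2) c = 0.
    by apply/(cocycleP A two_neq0); rewrite wE sE tE; apply: deformation_eqns.
  by exists (exist _ c c_cocycle); congr FirstOrderPart.
- move=> [c c_cocycle].
  have /(cocycleP A two_neq0) c_eqns := c_cocycle.
  have [D [wE sE tE]] := deformation_exists (cochain_multilinear c) c_eqns.
  by exists D; congr FirstOrderPart.
Qed.
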